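(* Let $\hat\gamma:\mathbb{R}/2\pi\mathbb{Z}\to(0,\infty)$ be globally $C^1$ and piecewise $C^2$, and suppose that (a) $3\hat\gamma(\theta)\ge\hat\gamma(\theta-\pi)$ for all $\theta\in\mathbb{R}/2\pi\mathbb{Z}$, and (b) $\hat\gamma'(\theta^* )=0$ for every $\theta^*\in\mathbb{R}/2\pi\mathbb{Z}$ with $3\hat\gamma(\theta^* )=\hat\gamma(\theta^*-\pi)$. Then, for sufficiently large $k(\theta)$, the SPFEM (the fully discrete scheme for closed curves defined in the context) is area conservative and unconditionally energy dissipative. That is, there is a function $k_*:\mathbb{R}/2\pi\mathbb{Z}\to[0,\infty)$ depending only on $\hat\gamma$ such that, for every stabilizing function $k:\mathbb{R}/2\pi\mathbb{Z}\to[0,\infty)$ with $k(\theta)\ge k_*(\theta)$ for all $\theta$, every $N>2$, every time step $\tau>0$ and every sequence of solutions $(\boldsymbol{X}^{m+1},\mu^{m+1})$, $m=0,1,2,\dots$, of the SPFEM, $$A_c^{m+1}=A_c^m=\cdots=A_c^0,\qquad W_c^{m+1}\le W_c^m\le\cdots\le W_c^0,\qquad\forall m\ge0.$$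
   Context: Notation. For $\boldsymbol{v}=(v_1,v_2)^T\in\mathbb{R}^2$, $\boldsymbol{v}^\perp=(v_2,-v_1)^T$. ''Piecewise $C^2$'' means the circle splits into finitely many closed arcs on each of which the function is $C^2$ (one-sided derivatives at endpoints). Surface energy matrix: $$\hat{\boldsymbol{G}}_k(\theta)=\begin{pmatrix}\hat\gamma(\theta)&-\hat\gamma'(\theta)\\ \hat\gamma'(\theta)&\hat\gamma(\theta)\end{pmatrix}+k(\theta)\begin{pmatrix}\sin^2\theta&-\cos\theta\sin\theta\\-\cos\theta\sin\theta&\cos^2\theta\end{pmatrix}.$$ Finite element spaces: $N>2$ an integer, $h=1/N$, $\rho_j=jh$, $I_j=[\rho_{j-1},\rho_j]$, $\mathbb{I}=[0,1]$. $\mathbb{K}^h$ is the space of continuous real functions on $\mathbb{I}$ that are affine on each $I_j$; $\mathbb{K}^h_p=\{u\in\mathbb{K}^h: u(0)=u(1)\}$; $\mathbb{X}^h_p=[\mathbb{K}^h_p]^2$. Discrete curves: $\Gamma^m=\boldsymbol{X}^m(\mathbb{I})$ with $\boldsymbol{X}^m=(x^m,y^m)^T\in\mathbb{X}^h_p$ approximates the curve at time $m\tau$; $\boldsymbol{h}^m_j=\boldsymbol{X}^m(\rho_j)-\boldsymbol{X}^m(\rho_{j-1})$, always assumed nonzero. The angle $\theta^m$ is the piecewise constant function with value $\theta^m_j$ on $I_j$, where $\boldsymbol{h}^m_j=|\boldsymbol{h}^m_j|(\cos\theta^m_j,\sin\theta^m_j)^T$. For $f\in\mathbb{K}^h$ (or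 vector-valued) the discrete derivative on $\Gamma^m$ is $\partial_sf|_{I_j}=\dfrac{f(\rho_j)-f(\rho_{j-1})}{|\boldsymbol{h}^m_j|}$. The mass-lumped inner product, for scalar or vector functions continuous on the interior of each $I_j$ with one-sided limits, is $$\bigl(u,v\bigr)^h_{\Gamma^m}=\frac12\sum_{j=1}^N|\boldsymbol{h}^m_j|\left((u\cdot v)(\rho_{j-1}^+)+(u\cdot v)(\rho_j^-)\right).$$ SPFEM: let $\boldsymbol{X}^0\in\mathbb{X}^h_p$ be given by $\boldsymbol{X}^0(\rho_j)=\boldsymbol{X}_0(\rho_j)$, $0\le j\le N$, for a closed initial curve $\boldsymbol{X}_0$. For $m=0,1,2,\dots$ find $(\boldsymbol{X}^{m+1},\mu^{m+1})\in\mathbb{X}^h_p\times\mathbb{K}^h_p$ such that $$\Bigl(\boldsymbol{n}^{m+\frac12}\cdot\tfrac{\boldsymbol{X}^{m+1}-\boldsymbol{X}^m}{\tau},\varphi^h\Bigr)^h_{\Gamma^m}+\Bigl(\partial_s\mu^{m+1},\partial_s\varphi^h\Bigr)^h_{\Gamma^m}=0,\quad\forall\varphi^h\in\mathbb{K}^h_p,$$ $$\Bigl(\mu^{m+1}\boldsymbol{n}^{m+\frac12},\boldsymbol{\omega}^h\Bigr)^h_{\Gamma^m}-\Bigl(\hat{\boldsymbol{G}}_k(\theta^m)\partial_s\boldsymbol{X}^{m+1},\partial_s\boldsymbol{\omega}^h\Bigr)^h_{\Gamma^m}=0,\quad\forall\boldsymbol{\omega}^h\in\mathbb{X}^h_p,$$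 where $\boldsymbol{n}^{m+\frac12}=-\frac12\frac{1}{|\partial_\rho\boldsymbol{X}^m|}(\partial_\rho\boldsymbol{X}^m+\partial_\rho\boldsymbol{X}^{m+1})^\perp$ (piecewise constant). Discrete area and energy: $$A^m_c=\frac12\sum_{j=1}^N\left(x^m(\rho_j)-x^m(\rho_{j-1})\right)\left(y^m(\rho_j)+y^m(\rho_{j-1})\right),\qquad W^m_c=\sum_{j=1}^N|\boldsymbol{h}^m_j|\,\hat\gamma(\theta^m_j).$$ *)

(* Defs.v *)
From HB Require Import structures.
From mathcomp Require Import all_boot all_order all_algebra.
From mathcomp Require Import all_classical all_reals all_analysis.

Set Implicit Arguments.
Unset Strict Implicit.
Unset Printing Implicit Defensive.

Import Order.TTheory GRing.Theory Num.Theory.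
Import numFieldNormedType.Exports.

Local Open Scope ring_scope.
Local Open Scope classical_set_scope.

(* Functions on the circle R/2piZ are 2pi-periodic functions R -> R. *)

Section Regularity.
Context {R : realType}.
Implicit Types (A : set R) (f g : R -> R).

(* The limit is taken inside A, so that it is a one-sided derivative at the
   endpoints of an interval A. *)
Definition has_deriv_on A f g : Prop :=
  forall x, A x -> (fun y => (f y - f x) / (y - x)) @ within A (x^') --> g x.

Definition C2_on A f : Prop :=
  exists f1 f2 : R -> R,
    [/\ has_deriv_on A f f1, has_deriv_on A f1 f2 & {within A, continuous f2}].

Definition C1 f : Prop :=
  (forall x, derivable f x 1) /\ continuous (derive1 f).

(* The circle is cut at the points t 0 < t 1 < ... < t n = t 0 + 2pi. *)
Definition piecewise_C2 f : Prop :=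
  exists (n : nat) (t : nat -> R),
    [/\ (0 < n)%N,
        forall i, (i < n)%N -> t i < t i.+1,
        t n = t 0%N + 2 * pi
      & forall i, (i < n)%N -> C2_on `[t i, t i.+1] f].

End Regularity.

Section Plane.
Context {R : realType}.
Implicit Types u v : 'cV[R]_2.

Definition vec2 (a b : R) : 'cV[R]_2 :=
  \col_(i < 2) (if i == 0 then a else b).

Definition mat2 (a b c d : R) : 'M[R]_2 :=
  \matrix_(i < 2, j < 2)
    (if i == 0 then (if j == 0 then a else b)
               else (if j == 0 then c else d)).

Definition dotv u v : R := (u^T *m v) 0 0.

(* The library norm of a matrix is the maximum norm. *)
Definition enorm v : R := Num.sqrt (dotv v v).

Definition perp v : 'cV[R]_2 := vec2 (v 1 0) (- v 0 0).

Definition energy_mx (gamma k : R -> R) (t : R) : 'M[R]_2 :=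
  mat2 (gamma t) (- derive1 gamma t)
       (derive1 gamma t) (gamma t)
  + k t *: mat2 (sin t ^+ 2) (- (cos t * sin t))
                (- (cos t * sin t)) (cos t ^+ 2).

End Plane.

(* The elements are numbered from 0: element j < N is [node N j, node N j.+1]. *)
Section FiniteElements.
Context {R : realType} (N : nat).

Definition node (j : nat) : R := j%:R / N%:R.

Definition Kh (u : R -> R) : Prop :=
  {within `[0, 1], continuous u} /\
  forall j, (j < N)%N -> exists a b : R,
    forall r, node j <= r <= node j.+1 -> u r = a * r + b.

Definition Khp (u : R -> R) : Prop := Kh u /\ u 0 = u 1.

Definition Xhp (X : R -> 'cV[R]_2) : Prop :=
  forall i : 'I_2, Khp (fun r => X r i 0).

(* The function with value c j on the interior of element j; its values at the
   nodes play no role, since only one-sided limits are taken there. *)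
Definition piecewise_const (V : Type) (c : nat -> V) (r : R) : V :=
  c (Num.truncn (r * N%:R)).

Definition edge (X : R -> 'cV[R]_2) (j : nat) : 'cV[R]_2 :=
  X (node j.+1) - X (node j).

Definition is_angle (X : R -> 'cV[R]_2) (theta : nat -> R) : Prop :=
  forall j, (j < N)%N ->
    edge X j = enorm (edge X j) *: vec2 (cos (theta j)) (sin (theta j)).

Definition ds (X : R -> 'cV[R]_2) (V : lmodType R) (f : R -> V) : R -> V :=
  piecewise_const
    (fun j => (enorm (edge X j))^-1 *: (f (node j.+1) - f (node j))).

(* The mass-lumped inner product of u and v on the curve X is
   [lumped X (u . v)]. *)
Definition lumped (X : R -> 'cV[R]_2) (f : R -> R) : R :=
  2^-1 * \sum_(j < N) enorm (edge X j) *
    (lim (f r @[r --> (node j)^'+]) + lim (f r @[r --> (node j.+1)^'-])).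

Definition half_normal (X X1 : R -> 'cV[R]_2) (r : R) : 'cV[R]_2 :=
  - (2^-1 * (enorm (derive1 X r))^-1) *: perp (derive1 X r + derive1 X1 r).

Definition area (X : R -> 'cV[R]_2) : R :=
  2^-1 * \sum_(j < N)
    (X (node j.+1) 0 0 - X (node j) 0 0)
    * (X (node j.+1) 1 0 + X (node j) 1 0).

Definition energy (gamma : R -> R) (X : R -> 'cV[R]_2) (theta : nat -> R) : R :=
  \sum_(j < N) enorm (edge X j) * gamma (theta j).

(* One time step, from the curve X with angle theta to the curve X1 with
   chemical potential mu1. *)
Definition spfem_step (gamma k : R -> R) (tau : R) (X : R -> 'cV[R]_2)
    (theta : nat -> R) (X1 : R -> 'cV[R]_2) (mu1 : R -> R) : Prop :=
  let n := half_normal X X1 in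
  let th := piecewise_const theta in
  [/\ Xhp X1, Khp mu1,
      forall phi : R -> R, Khp phi ->
        lumped X (fun r => dotv (n r) (tau^-1 *: (X1 r - X r)) * phi r)
        + lumped X (fun r => ds X (mu1 : R -> R^o) r * ds X (phi : R -> R^o) r)
        = 0
    & forall w : R -> 'cV[R]_2, Xhp w ->
        lumped X (fun r => dotv (mu1 r *: n r) (w r))
        - lumped X (fun r =>
            dotv (energy_mx gamma k (th r) *m ds X X1 r) (ds X w r))
        = 0].

(* X is the sequence of discrete curves, theta m the angle of X m, and mu m.+1
   the chemical potential of step m; mu 0 is unused. *)
Definition spfem_solution (gamma k : R -> R) (tau : R)
    (Xinit : R -> 'cV[R]_2) (X : nat -> R -> 'cV[R]_2)
    (theta : nat -> nat -> R) (mu : nat -> R -> R) : Prop :=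
  [/\ Xhp (X 0%N),
      forall j, (j <= N)%N -> X 0%N (node j) = Xinit (node j),
      forall m j, (j < N)%N -> edge (X m) j != 0,
      forall m, is_angle (X m) (theta m)
    & forall m, spfem_step gamma k tau (X m) (theta m) (X m.+1) (mu m.+1)].

End FiniteElements.

(* Main.v *)
Require Import Defs.
From mathcomp Require Import all_boot all_order all_algebra.
From mathcomp Require Import all_classical all_reals all_analysis.
From mathcomp Require Import ring lra.

Set Implicit Arguments.
Unset Strict Implicit.
Unset Printing Implicit Defensive.

Import Order.TTheory GRing.Theory Num.Theory.
Import numFieldNormedType.Exports.

Local Open Scope ring_scope.
Local Open Scope classical_set_scope.

(** Everything reduces to one inequality per edge. Let an edge of X have
    length a and angle t, and the same edge of the next curve Y length b and
    angle s = t + d. Testing the second equation of the scheme with Y - X and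
    the first one with the chemical potential makes the weighted normal
    velocity cancel, which leaves
      sum over edges of (1/a) (G(t) y) . (y - x) = - tau * (integral of |ds mu|^2) <= 0,
    where x and y are the edge vectors of X and Y. The energy therefore
    decreases as soon as each summand is at least
    b gamma(s) - a gamma(t) (edge_energy_le). With r = b / a, this is
    the statement that for all r >= 0 and all d
      r Q(d) <= gamma(t) + r^2 (gamma(t) + k(t) sin^2 d),
      Q(d) = gamma(t + d) + gamma(t) cos d - gamma'(t) sin d,
    which is what [stabilizing] says of k(t).

    The quadratic in r is nonnegative for k(t) large once
      Q(d) <= 2 gamma(t) + C sin^2 d for all d
    with some constant C (stabilizing_exists). By compactness of a period such
    a bound only has to be found near each d0 (anisotropy_local). It is clear
    where sin d0 does not vanish. At d0 = 0, Q equals 2 gamma(t) and Q' = 0.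
    At d0 = pi, Q = gamma(t - pi) - gamma(t) is at most 2 gamma(t) by (a), and
    in the case of equality Q' = gamma'(t) + gamma'(t - pi) vanishes: the
    first term by (b), the second because t then minimizes the
    nonnegative function 3 gamma - gamma(. - pi). So wherever Q touches
    2 gamma(t) at a zero of the sine it has a critical point there; as gamma'
    has one-sided difference quotients that stay bounded
    (derive1_gamma_lipschitz_at), Q exceeds 2 gamma(t) by at most a multiple of
    (d - d0)^2, that is, of sin^2 d. The function kstar picks one admissible
    value for each t; admissibility at t and at t + 2 pi are the same
    predicate, so kstar is periodic.

    For the area, the test function 1 says that the integral of the normal
    velocity is zero. As the normal averages the two curves, edge by edge this
    integral is the difference of the two areas up to the increment of a
    periodic quantity (normal_velocity_area_term), which telescopes. *)

(** * Pointwise Lipschitz functions *)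

Definition lipschitz_at {R : realType} (g : R -> R) (x : R) : Prop :=
  exists C d : R, 0 < d /\
    forall y, `|y - x| <= d -> `|g y - g x| <= C * `|y - x|.

Definition right_lipschitz_at {R : realType} (g : R -> R) (x : R) : Prop :=
  exists C d : R, 0 < d /\
    forall y, 0 <= y - x <= d -> `|g y - g x| <= C * `|y - x|.

Definition left_lipschitz_at {R : realType} (g : R -> R) (x : R) : Prop :=
  exists C d : R, 0 < d /\
    forall y, - d <= y - x <= 0 -> `|g y - g x| <= C * `|y - x|.

Lemma lipschitz_at_sided {R : realType} (g : R -> R) (x : R) :
  right_lipschitz_at g x -> left_lipschitz_at g x -> lipschitz_at g x.
Proof.
move=> [C [d [d0 Cd]]] [D [e [e0 De]]].
exists (Num.max C D), (Num.min d e); split; first by rewrite lt_min d0.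
move=> y; rewrite le_min => /andP[yd ye].
case: (leP x y) => xy.
- apply: (le_trans (Cd _ _)); last by rewrite ler_wpM2r// le_max lexx.
  by rewrite subr_ge0 xy (le_trans (ler_norm _) yd).
- apply: (le_trans (De _ _)); last by rewrite ler_wpM2r// le_max lexx orbT.
  by rewrite subr_le0 (ltW xy) andbT; move: ye; rewrite ler_norml => /andP[].
Qed.

Lemma lipschitz_atD {R : realType} (f g : R -> R) (x : R) :
  lipschitz_at f x -> lipschitz_at g x ->
  lipschitz_at (fun y => f y + g y) x.
Proof.
move=> [C [d [d0 Cd]]] [D [e [e0 De]]].
exists (C + D), (Num.min d e); split; first by rewrite lt_min d0.
move=> y; rewrite le_min => /andP[yd ye].
rewrite opprD addrACA mulrDl (le_trans (ler_normD _ _))//.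
by rewrite lerD// ?Cd// De.
Qed.

Lemma is_derive_lipschitz_at {R : realType} (f : R -> R) (x a : R) :
  is_derive x 1 f a -> lipschitz_at f x.
Proof.
move=> /is_derive1_caratheodory[g [fg gc _]].
have : \forall y \near x, `|g y| <= `|g x| + 1.
  by apply: (cvgr_norm_le _ gc); rewrite ltrDl.
move=> /nbhs_normP[d /= d0 H].
exists (`|g x| + 1), (d / 2); split; first by rewrite divr_gt0.
move=> y yd; rewrite fg normrM ler_wpM2r//; apply: H => /=.
by rewrite distrC (le_lt_trans yd)// ltr_pdivrMr// ltr_pMr// ltr1n.
Qed.

(** The slope at an intermediate point is at most a multiple of its distance
    to the critical point, so the mean value theorem gives a quadratic bound. *)
Lemma critical_point_le_quadratic {R : realType} (f f' : R -> R) (x : R) :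
  (forall y : R, is_derive y 1 f (f' y)) -> f' x = 0 -> lipschitz_at f' x ->
  exists C d : R, 0 < d /\
    forall y, `|y - x| <= d -> f y <= f x + C * (y - x) ^+ 2.
Proof.
move=> df f'x [C [d [d0 Cd]]]; exists `|C|, d; split => // y yd.
have fc z : {for z, continuous f}.
  by apply/differentiable_continuous/derivable1_diffP; case: (df z).
have key a b : a <= b ->
    exists2 c, c \in `[a, b]%R & f b - f a = f' c * (b - a).
  move=> ab.
  exact: (MVT_segment ab (fun z _ => df z) (continuous_subspaceT fc)).
have bound c : `|c - x| <= `|y - x| -> `|f' c| <= `|C| * `|y - x|.
  move=> cy; rewrite -[f' c]subr0 -f'x (le_trans (Cd _ (le_trans cy yd)))//.
  by rewrite (le_trans (ler_wpM2r _ (ler_norm C)))// ler_wpM2l.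
suff [c [cy fE]] : exists c, `|c - x| <= `|y - x| /\ f y - f x = f' c * (y - x).
  rewrite addrC -lerBlDr fE (le_trans (ler_norm _))// normrM.
  rewrite -[(y - x) ^+ 2]real_normK ?num_real// expr2 mulrA.
  by rewrite ler_wpM2r// bound.
case: (leP x y) => xy.
- have [c cI fE] := key _ _ xy; exists c; split => //.
  move: cI; rewrite in_itv/= => /andP[c1 c2].
  by rewrite !ger0_norm ?subr_ge0// lerB.
- have [c cI fE] := key _ _ (ltW xy); exists c.
  move: cI; rewrite in_itv/= => /andP[c1 c2]; split.
    by rewrite !ler0_norm ?subr_le0// ?(ltW xy)// lerN2 lerB.
  by rewrite -opprB fE -mulrN opprB.
Qed.

(** * Derivatives relative to a closed interval *)

Lemma has_deriv_on_quotient_bound {R : realType} (A : set R) (f f1 : R -> R)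
    (x : R) :
  has_deriv_on A f f1 -> A x ->
  exists C d : R, 0 < d /\
    forall y, A y -> `|y - x| <= d -> `|f y - f x| <= C * `|y - x|.
Proof.
move=> fA Ax.
have : \forall y \near within A x^', `|(f y - f x) / (y - x)| <= `|f1 x| + 1.
  by apply: (cvgr_norm_le _ (fA _ Ax)); rewrite ltrDl.
rewrite near_withinE near_withinE => /nbhs_normP[d /= d0 H].
exists (`|f1 x| + 1), (d / 2); split; first by rewrite divr_gt0.
move=> y Ay yd; have [->|yx] := eqVneq y x.
  by rewrite !subrr normr0 mulr0.
have := H y; rewrite /= distrC => H'.
have := H' _ yx Ay.
rewrite normrM normfV ler_pdivrMr ?normr_gt0 ?subr_eq0//; apply.
by rewrite (le_lt_trans yd)// ltr_pdivrMr// ltr_pMr// ltr1n.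
Qed.

(** Limits along this filter are unique even at the endpoints, because a
    nondegenerate interval accumulates at each of its points. *)
Lemma within_itv_dnbhs_proper {R : realType} (a b x : R) :
  a < b -> a <= x <= b -> ProperFilter (within `[a, b]%classic x^').
Proof.
move=> ab /andP[ax xb]; apply: Build_ProperFilter_ex => P.
change ((\forall y \near within `[a, b]%classic x^', P y) -> exists y, P y).
rewrite near_withinE near_withinE => /nbhs_normP[e /= e0 H].
have [xb'|bx] := ltP x b.
- exists (Num.min (x + e / 2) b); apply: H => /=.
  + rewrite ltr_norml; case: (leP (x + e / 2) b) => h; apply/andP; split; lra.
  + by rewrite gt_eqF// lt_min xb' ltrDl divr_gt0.
  + rewrite in_itv/= ge_min lexx orbT le_min (ltW ab)/= (le_trans ax)//.
    by rewrite lerDl divr_ge0// ltW.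
- have xE : x = b by apply/eqP; rewrite eq_le xb.
  subst x.
  exists (Num.max (b - e / 2) a); apply: H => /=.
  + rewrite ltr_norml; case: (leP (b - e / 2) a) => h; apply/andP; split; lra.
  + by rewrite lt_eqF// gt_max ab andbT ltrBlDr ltrDl divr_gt0.
  + rewrite in_itv/= le_max lexx orbT ge_max (ltW ab) andbT lerBlDr lerDl.
    by rewrite divr_ge0// ltW.
Qed.

(** At an endpoint both limits are taken along the same one-sided filter, hence
    they agree; this identifies the derivative given on a piece of a piecewise
    smooth function with its global derivative. *)
Lemma has_deriv_onE {R : realType} (a b : R) (f f1 : R -> R) (x : R) :
  a < b -> a <= x <= b -> has_deriv_on `[a, b] f f1 -> derivable f x 1 ->
  f1 x = derive1 f x.
Proof.
move=> ab xab fA /derivableP; rewrite -derive1E.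
move=> /is_derive1_caratheodory[g [fg gc <-]].
have /fA fx : `[a, b]%classic x by rewrite /= in_itv.
have fgx : (f y - f x) / (y - x) @[y --> within `[a, b]%classic x^'] --> g x.
  apply: (@cvg_trans _ (g y @[y --> within `[a, b]%classic x^'])).
    apply: near_eq_cvg; rewrite near_withinE near_withinE.
    near=> y => yx _; rewrite fg mulfK ?subr_eq0//.
  apply: cvg_trans gc; apply: cvg_app.
  exact: cvg_trans (cvg_within _) (cvg_within _).
have PF := within_itv_dnbhs_proper ab xab.
exact: (cvg_unique _ fx fgx).
Unshelve. all: by end_near. Qed.

(** * Periodic functions and subdivisions of a period *)

Lemma periodic_int {R : realType} (f : R -> R) (T : R) (n : int) :
  periodic f T -> forall x, f (x + n%:~R * T) = f x.
Proof.
move=> fT x; case: n => n.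
  by rewrite -pmulrn mulr_natl periodicn.
rewrite NegzE mulrNz mulNr -pmulrn mulr_natl.
by rewrite -[in RHS](subrK (T *+ n.+1) x) periodicn.
Qed.

Lemma derive1_shift {R : realType} (f : R -> R) (c x : R) :
  (forall y, derivable f y 1) ->
  derive1 (fun y => f (y + c)) x = derive1 f (x + c).
Proof.
move=> df; have := derivableP (df (x + c)); rewrite -derive1E.
move=> /is_derive1_caratheodory[g [fg gc <-]].
rewrite derive1E; apply: derive_val; apply/is_derive1_caratheodory.
exists (fun y => g (y + c)); split => //.
  by move=> z; rewrite fg opprD addrACA subrr addr0.
have := gc; rewrite /continuous_at => gc'.
apply: (@continuous_comp _ _ _ (fun y => y + c) g) => //.
apply: cvgD; [exact: cvg_id|exact: cvg_cst].
Qed.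

Lemma periodic_derive1 {R : realType} (f : R -> R) (T : R) :
  (forall y, derivable f y 1) -> periodic f T -> periodic (derive1 f) T.
Proof.
move=> df fT x; rewrite -derive1_shift//; congr derive1.
exact/funext.
Qed.

Lemma period_repr {R : realType} (T a x : R) : 0 < T ->
  exists n : int, a <= x + n%:~R * T < a + T.
Proof.
move=> T0; exists (- Num.floor ((x - a) / T)).
have /andP[h1 h2] := floor_itv ((x - a) / T).
move: h1 h2; rewrite ler_pdivlMr// ltr_pdivrMr//.
rewrite [in X in _ < X]intrD [in X in _ < X]mulrDl mul1r.
by rewrite mulrNz mulNr; set z := _%:~R * T => h1 h2; apply/andP; split; lra.
Qed.

Lemma subdivision_right {R : realType} (n : nat) (t : nat -> R) (x : R) :
  t 0%N <= x < t n -> exists2 i, (i < n)%N & t i <= x < t i.+1.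
Proof.
elim: n => [/andP[h1 h2]|n IH /andP[h1 h2]].
  by have := le_lt_trans h1 h2; rewrite ltxx.
have [xn|nx] := ltP x (t n); last by exists n; rewrite ?nx.
have [|i ni xi] := IH; first by rewrite h1.
by exists i => //; exact: ltnW.
Qed.

Lemma subdivision_left {R : realType} (n : nat) (t : nat -> R) (x : R) :
  t 0%N < x <= t n -> exists2 i, (i < n)%N & t i < x <= t i.+1.
Proof.
elim: n => [/andP[h1 h2]|n IH /andP[h1 h2]].
  by have := lt_le_trans h1 h2; rewrite ltxx.
have [nx|xn] := ltP (t n) x; first by exists n; rewrite ?nx.
have [|i ni xi] := IH; first by rewrite h1.
by exists i => //; exact: ltnW.
Qed.

(** * Regularity of the derivative of the energy density *)

Section SurfaceEnergy.
Context {R : realType} (gamma : R -> R).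
Context (gamma_per : periodic gamma (2 * pi)).
Context (gamma_C1 : C1 gamma).

Let pi2_gt0 : 0 < 2 * pi :> R. Proof. by rewrite mulr_gt0 ?pi_gt0. Qed.

Lemma is_derive_gamma (x : R) : is_derive x 1 gamma (derive1 gamma x).
Proof. by rewrite derive1E; apply: derivableP; case: gamma_C1. Qed.

Lemma derive1_gamma_per : periodic (derive1 gamma) (2 * pi).
Proof. by apply: periodic_derive1 => //; case: gamma_C1. Qed.

Lemma C2_on_derive1_bound a b x : a < b -> C2_on `[a, b] gamma -> a <= x <= b ->
  exists C d : R, 0 < d /\
    forall y, a <= y <= b -> `|y - x| <= d ->
      `|derive1 gamma y - derive1 gamma x| <= C * `|y - x|.
Proof.
move=> ab [f1 [f2 [h1 h2 _]]] xab.
have [|C [d [d0 Cd]]] := has_deriv_on_quotient_bound h2 (x := x).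
  by rewrite /= in_itv.
exists C, d; split => // y yab yd.
have f1E z : a <= z <= b -> f1 z = derive1 gamma z.
  by move=> zab; apply: (has_deriv_onE ab zab h1); case: gamma_C1.
by rewrite -!f1E//; apply: Cd => //=; rewrite in_itv.
Qed.

(** The piece that starts at or contains x bounds the right-hand quotients, the
    piece that ends at or contains x the left-hand ones. The breakpoints cover
    one period only, so x is first moved there. *)
Lemma derive1_gamma_lipschitz_at x :
  piecewise_C2 gamma -> lipschitz_at (derive1 gamma) x.
Proof.
move=> [n [t [n0 tlt tn tC2]]]; apply: lipschitz_at_sided.
- have [m] := period_repr (t 0%N) x pi2_gt0.
  rewrite -tn => /subdivision_right[i ni /andP[x1 x2]].
  have [|C [d [d0 Cd]]] := C2_on_derive1_bound (x := x + m%:~R * (2 * pi))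
    (tlt _ ni) (tC2 _ ni); first by rewrite x1 ltW.
  exists C, (Num.min d (t i.+1 - (x + m%:~R * (2 * pi)))); split.
    by rewrite lt_min d0 subr_gt0.
  move=> y; rewrite le_min => /and3P[y0 yd yt].
  rewrite -(periodic_int m derive1_gamma_per y).
  rewrite -(periodic_int m derive1_gamma_per x).
  have yxE : y + m%:~R * (2 * pi) - (x + m%:~R * (2 * pi)) = y - x by ring.
  rewrite -yxE; apply: Cd; first by apply/andP; split; lra.
  by rewrite yxE ger0_norm.
(* Reflecting x turns the representative in a right-open period into one in a
   left-open period. *)
- have [m] := period_repr (- t n) (- x) pi2_gt0.
  rewrite {2}tn opprD subrK => /andP[x1 x2].
  have xE : x + (- m)%:~R * (2 * pi) = - (- x + m%:~R * (2 * pi)).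
    by rewrite mulrNz; ring.
  have /subdivision_left[i ni /andP[x3 x4]] :
      t 0%N < x + (- m)%:~R * (2 * pi) <= t n.
    by rewrite xE ltrNr x2/= lerNl.
  have [|C [d [d0 Cd]]] := C2_on_derive1_bound (x := x + (- m)%:~R * (2 * pi))
    (tlt _ ni) (tC2 _ ni); first by rewrite x4 ltW.
  exists C, (Num.min d (x + (- m)%:~R * (2 * pi) - t i)); split.
    by rewrite lt_min d0 subr_gt0.
  move=> y /andP[yd y0].
  have yd' : x - y <= Num.min d (x + (- m)%:~R * (2 * pi) - t i) by lra.
  move: yd'; rewrite le_min => /andP[yd' yt].
  rewrite -(periodic_int (- m) derive1_gamma_per y).
  rewrite -(periodic_int (- m) derive1_gamma_per x).
  have yxE : y + (- m)%:~R * (2 * pi) - (x + (- m)%:~R * (2 * pi)) = y - x.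
    by ring.
  rewrite -yxE; apply: Cd; first by apply/andP; split; lra.
  by rewrite yxE ler0_norm// opprB.
Qed.

End SurfaceEnergy.

(** * Stabilizing values *)

(** The part of the edgewise energy balance that is linear in the length ratio,
    as a function of the turning angle d of an edge of angle t. *)
Definition anisotropy {R : realType} (gamma : R -> R) (t d : R) : R :=
  gamma (t + d) + gamma t * cos d - derive1 gamma t * sin d.

Lemma derive1_minimum {R : realType} (f : R -> R) (c a : R) :
  (forall y : R, derivable f y 1) -> (forall y, f c <= f y) ->
  is_derive c 1 f a -> a = 0.
Proof.
move=> df fc fa.
have := @derive1_at_min R f (c - 1) (c + 1) c.
case=> [||||_]; rewrite ?in_itv/= ?ltrBlDr ?ltrDl ?ltr01//.
  by rewrite lerBlDr -addrA lerDl.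
by move=> <-; rewrite derive_val.
Qed.

Lemma sin_eq0_period {R : realType} (d : R) : 0 <= d <= 2 * pi -> sin d = 0 ->
  [\/ d = 0, d = pi | d = 2 * pi].
Proof.
move=> /andP[d0 d1] sd.
have [dpi|pid|->] := ltgtP d pi; last by apply: Or32.
- apply: Or31; apply/eqP; rewrite eq_le d0 andbT leNgt; apply/negP => d0'.
  by have := sin_gt0_pi (x := d); rewrite d0' dpi sd ltxx => /(_ isT).
- apply: Or33; apply/eqP; rewrite eq_le d1/= leNgt; apply/negP => d1'.
  have := sin_gt0_pi (x := d - pi); rewrite subr_gt0 pid/=.
  have := sinDpi (d - pi); rewrite subrK sd => /eqP.
  rewrite eq_sym oppr_eq0 => /eqP ->; rewrite ltxx => H.
  by have := H ltac:(lra).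
Qed.

(** Every zero of the sine is simple, with slope 1 or -1; near it the slope of
    the chord is at least 1/2 in absolute value. *)
Lemma sin_simple_zero {R : realType} (d0 : R) : sin d0 = 0 ->
  exists e : R, 0 < e /\
    forall d, `|d - d0| <= e -> (d - d0) ^+ 2 <= 4 * sin d ^+ 2.
Proof.
move=> s0; have := is_derive_sin d0.
move=> /is_derive1_caratheodory[g [sg gc gd0]].
have g1 : `|g d0| = 1 by rewrite gd0; exact: sin0cos1.
have : \forall d \near d0, 2^-1 < `|g d|.
  apply: (cvgr_norm_gt _ gc); rewrite g1 invf_lt1// ltr1n//.
move=> /nbhs_normP[e /= e0 H].
exists (e / 2); split; first by rewrite divr_gt0.
move=> d de; have {H}gd : 2^-1 < `|g d|.
  apply: H => /=; rewrite distrC (le_lt_trans de)//.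
  by rewrite ltr_pdivrMr// ltr_pMr// ltr1n.
have := sg d; rewrite s0 subr0 => ->.
rewrite exprMn mulrA ler_peMl ?sqr_ge0//.
rewrite -[g d ^+ 2]real_normK ?num_real//; nra.
Qed.

(** Here r stands for the ratio of the new to the old length of an edge. *)
Definition stabilizing {R : realType} (gamma : R -> R) (t K : R) : Prop :=
  0 <= K /\ forall d r, 0 <= r ->
    r * anisotropy gamma t d <=
      gamma t + r ^+ 2 * (gamma t + K * sin d ^+ 2).

Section Anisotropy.
Context {R : realType} (gamma : R -> R).
Context (gamma_per : periodic gamma (2 * pi)).
Context (gamma_gt0 : forall t, 0 < gamma t).
Context (gamma_C1 : C1 gamma).
Context (gamma_pC2 : piecewise_C2 gamma).
Context (gamma_a : forall t, gamma (t - pi) <= 3 * gamma t).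
Context (gamma_b :
  forall t, 3 * gamma t = gamma (t - pi) -> derive1 gamma t = 0).

Let dgamma := is_derive_gamma gamma_C1.

Definition anisotropy' (t d : R) : R :=
  derive1 gamma (t + d) - gamma t * sin d - derive1 gamma t * cos d.

Lemma is_derive_anisotropy t (d : R) :
  is_derive d 1 (anisotropy gamma t) (anisotropy' t d).
Proof.
have h : is_derive d 1 (fun y => gamma (t + y)) (derive1 gamma (t + d)).
  have h1 : is_derive d 1 (fun y => t + y) 1.
    have := is_deriveD (is_derive_cst t d 1) (is_derive_id d 1).
    by rewrite add0r.
  by have := is_derive1_comp (dgamma (t + d)) h1; rewrite mulr1.
have hc : is_derive d 1 (fun y => gamma t * cos y) (gamma t * - sin d).
  exact: (is_deriveZ (gamma t) (is_derive_cos d)).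
have hs : is_derive d 1 (fun y => derive1 gamma t * sin y)
    (derive1 gamma t * cos d).
  exact: (is_deriveZ (derive1 gamma t) (is_derive_sin d)).
apply: (is_derive_eq (is_deriveB (is_deriveD h hc) hs)).
by rewrite /anisotropy' mulrN.
Qed.

Lemma continuous_anisotropy t : continuous (anisotropy gamma t).
Proof.
move=> d; apply/differentiable_continuous/derivable1_diffP.
by case: (is_derive_anisotropy t d).
Qed.

Lemma anisotropy'_lipschitz_at t d : lipschitz_at (anisotropy' t) d.
Proof.
apply: lipschitz_atD.
  apply: lipschitz_atD.
    have [C [e [e0 Ce]]] :=
      derive1_gamma_lipschitz_at gamma_per gamma_C1 (t + d) gamma_pC2.
    exists C, e; split => // y ye.
    by have := Ce (t + y); rewrite opprD addrACA subrr add0r; apply.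
  apply: is_derive_lipschitz_at.
apply: is_derive_lipschitz_at.
Qed.

(** At d = 0 and d = 2 pi both claims are identities. At d = pi the bound is
    hypothesis (a); in the case of equality the nonnegative function
    3 gamma - gamma(. - pi) vanishes, hence is minimal, at t, so that
    gamma'(t - pi) = 3 gamma'(t), which is 0 by (b). *)
Lemma anisotropy_touch t d : sin d = 0 -> 0 <= d <= 2 * pi ->
  anisotropy gamma t d <= 2 * gamma t /\
  (anisotropy gamma t d = 2 * gamma t -> anisotropy' t d = 0).
Proof.
move=> sd dI.
have per0 : gamma (t + 2 * pi) = gamma t by [].
have per1 : derive1 gamma (t + 2 * pi) = derive1 gamma t.
  exact: derive1_gamma_per.
rewrite /anisotropy /anisotropy'.
have [->|->|->] := sin_eq0_period dI sd.
- rewrite addr0 cos0 sin0; split; first lra.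
  by move=> _; ring.
- have tpi (f : R -> R) : periodic f (2 * pi) -> f (t + pi) = f (t - pi).
    by move=> fp; rewrite -[RHS]fp; congr (f _); ring.
  rewrite sinpi cospi (tpi _ gamma_per).
  rewrite (tpi _ (derive1_gamma_per gamma_per gamma_C1)).
  split; first by have := gamma_a t; lra.
  move=> E; have E3 : 3 * gamma t = gamma (t - pi) by lra.
  have g0 := gamma_b E3.
  (* (b) controls gamma' at t; minimality controls it at t - pi *)
  have dF (y : R) : is_derive y 1 (fun y => 3 * gamma y - gamma (y - pi))
      (3 * derive1 gamma y - derive1 gamma (y - pi)).
    have h1 : is_derive y 1 (fun y => y - pi) 1.
      have := is_deriveB (is_derive_id y 1) (is_derive_cst pi y 1).
      by rewrite subr0.
    have h2 := @is_derive1_comp _ gamma (fun y => y - pi) y _ _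
      (dgamma (y - pi)) h1.
    have h3 := is_deriveZ 3 (dgamma y).
    by apply: (is_derive_eq (is_deriveB h3 h2)); rewrite mulr1.
  have : 3 * derive1 gamma t - derive1 gamma (t - pi) = 0.
    apply: (derive1_minimum _ _ (dF t)) => y; first by case: (dF y).
    by rewrite E3 subrr subr_ge0.
  rewrite g0; lra.
- have cos2pi' : cos (2 * pi) = 1 :> R by rewrite mulr_natl cos2pi.
  have sin2pi' : sin (2 * pi) = 0 :> R by rewrite mulr_natl sin2pi.
  rewrite per0 per1 cos2pi' sin2pi'; split; first lra.
  by move=> _; ring.
Qed.

Lemma anisotropy_local t d0 : 0 <= d0 <= 2 * pi ->
  exists C : R, \forall d \near d0,
    anisotropy gamma t d <= 2 * gamma t + C * sin d ^+ 2.
Proof.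
move=> dI; have gt0 := gamma_gt0 t.
have Qc := continuous_anisotropy (t := t) (x := d0).
have [sd|sd] := eqVneq (sin d0) 0; last first.
  (* near d0, sin^2 d is at least sin^2 d0 / 4 *)
  exists ((`|anisotropy gamma t d0| + 1) * (4 / sin d0 ^+ 2)).
  have h1 : \forall d \near d0,
      anisotropy gamma t d < `|anisotropy gamma t d0| + 1.
    by apply: (cvgr_lt _ Qc); rewrite (le_lt_trans (ler_norm _))// ltrDl.
  have h2 : \forall d \near d0, `|sin d0| / 2 < `|sin d|.
    apply: (cvgr_norm_gt _ (continuous_sin (x := d0))).
    by rewrite ltr_pdivrMr// ltr_pMr ?normr_gt0// ltr1n.
  near=> d.
  have hd1 : anisotropy gamma t d < `|anisotropy gamma t d0| + 1 by near: d.
  have hd2 : `|sin d0| / 2 < `|sin d| by near: d.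
  have s0 : 0 < `|sin d0| by rewrite normr_gt0.
  have h3 : 1 <= 4 / sin d0 ^+ 2 * sin d ^+ 2.
    rewrite -[sin d ^+ 2]real_normK ?num_real//.
    rewrite -[sin d0 ^+ 2]real_normK ?num_real//.
    rewrite mulrAC ler_pdivlMr ?exprn_gt0//; nra.
  have := normr_ge0 (anisotropy gamma t d0); rewrite -mulrA; nra.
have [Qle Qcrit] := anisotropy_touch t sd dI.
have [Qlt|Qge] := ltP (anisotropy gamma t d0) (2 * gamma t).
  exists 0; near=> d; rewrite mul0r addr0 ltW//.
  by near: d; apply: (cvgr_lt _ Qc).
have QE : anisotropy gamma t d0 = 2 * gamma t by apply/eqP; rewrite eq_le Qle.
have [C [e [e0 He]]] := critical_point_le_quadratic (is_derive_anisotropy t)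
  (Qcrit QE) (anisotropy'_lipschitz_at t d0).
have [e' [e'0 He']] := sin_simple_zero sd.
have near_d0 (r : R) : 0 < r -> \forall d \near d0, `|d - d0| <= r.
  by move=> r0; apply/nbhs_normP; exists r => //= y; rewrite distrC => /ltW.
exists (4 * `|C|).
near=> d; rewrite -QE; apply: (le_trans (He _ _)).
  by near: d; exact: near_d0.
rewrite lerD2l mulrAC mulrC.
have de' : (d - d0) ^+ 2 <= 4 * sin d ^+ 2.
  by apply: He'; near: d; exact: near_d0.
have := ler_norm C; have := normr_ge0 C; have := sqr_ge0 (d - d0); nra.
Unshelve. all: by end_near. Qed.

Lemma anisotropy_per t : periodic (anisotropy gamma t) (2 * pi).
Proof.
move=> d; rewrite /anisotropy addrA gamma_per.
by rewrite [2 * pi]mulr_natl cosD2pi sinD2pi.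
Qed.

(** The local constants can be made uniform because a period is compact and a
    larger constant only weakens the bound. *)
Lemma anisotropy_bound t : exists2 C : R, 0 <= C &
  forall d, anisotropy gamma t d <= 2 * gamma t + C * sin d ^+ 2.
Proof.
have : \forall C \near +oo, `[0, 2 * pi]%classic `<=`
    [set d | anisotropy gamma t d <= 2 * gamma t + C * sin d ^+ 2].
  move: (@segment_compact R 0 (2 * pi)) => /compact_near_coveringP; apply.
  move=> d0 /=; rewrite in_itv/= => /(anisotropy_local t)[C HC].
  exists ([set d | anisotropy gamma t d <= 2 * gamma t + C * sin d ^+ 2],
          [set D : R | C <= D]) => /=.
    by split; [exact: HC|exact: nbhs_pinfty_ge (num_real _)].
  move=> [d D] [/= h1 h2]; rewrite (le_trans h1)// lerD2l ler_wpM2r ?sqr_ge0//.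
move=> H.
near (pinfty_nbhs R) => C.
exists C; first by near: C; apply: nbhs_pinfty_ge; rewrite num_real.
move=> d.
have pi2 : 0 < 2 * pi :> R by rewrite mulr_gt0 ?pi_gt0.
have [n /andP[n1 n2]] := period_repr 0 d pi2.
have HC : `[0, 2 * pi]%classic `<=`
    [set d | anisotropy gamma t d <= 2 * gamma t + C * sin d ^+ 2] by near: C.
have := HC (d + n%:~R * (2 * pi)).
rewrite /= in_itv/= n1 => /(_ ltac:(lra)).
rewrite (periodic_int n (@anisotropy_per t)).
have sinper : periodic sin (2 * pi : R) by rewrite mulr_natl; exact: sinD2pi.
by rewrite (periodic_int n sinper).
Unshelve. all: by end_near. Qed.

(** Writing s = sin^2 d, the value of K makes the difference of the two sides,
    multiplied by gamma t, equal to
    (gamma t - (gamma t + C s / 2) r)^2 + r^2 C^2 s (1 - s) / 4. *)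
Lemma stabilizing_exists t : exists K, stabilizing gamma t K.
Proof.
have [C C0 HC] := anisotropy_bound t; have g0 := gamma_gt0 t.
exists (C + C ^+ 2 / (4 * gamma t)); split.
  by rewrite addr_ge0// divr_ge0 ?sqr_ge0// mulr_ge0// ltW.
move=> d r r0; apply: (le_trans (ler_wpM2l r0 (HC d))).
have s0 := sqr_ge0 (sin d).
have s1 : sin d ^+ 2 <= 1 by rewrite -(cos2Dsin2 d) lerDr sqr_ge0.
move: s0 s1; set s := sin d ^+ 2 => s0 s1.
rewrite -subr_ge0 -(pmulr_rge0 _ g0).
have -> : gamma t * (gamma t
      + r ^+ 2 * (gamma t + (C + C ^+ 2 / (4 * gamma t)) * s)
      - r * (2 * gamma t + C * s)) =
    (gamma t - (gamma t + C * s / 2) * r) ^+ 2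
      + r ^+ 2 * C ^+ 2 * s * (1 - s) / 4.
  by field; rewrite gt_eqF.
apply: addr_ge0; first exact: sqr_ge0.
apply: divr_ge0 => //; apply: mulr_ge0; last by rewrite subr_ge0.
by apply: mulr_ge0 => //; apply: mulr_ge0; exact: sqr_ge0.
Qed.

Lemma stabilizing_per t : stabilizing gamma (t + 2 * pi) = stabilizing gamma t.
Proof.
apply/funext => K; rewrite /stabilizing gamma_per; congr (_ /\ _).
suff E d : anisotropy gamma (t + 2 * pi) d = anisotropy gamma t d.
  by apply/propext; split => H d; [rewrite -E|rewrite E]; exact: H.
rewrite /anisotropy gamma_per (derive1_gamma_per gamma_per gamma_C1).
by rewrite [t + _ + d]addrAC gamma_per.
Qed.

Lemma stabilizing_le t K L : K <= L ->
  stabilizing gamma t K -> stabilizing gamma t L.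
Proof.
move=> KL [K0 HK]; split; first exact: le_trans KL.
move=> d r r0; apply: (le_trans (HK d r r0)).
by rewrite lerD2l ler_wpM2l ?sqr_ge0// lerD2l ler_wpM2r ?sqr_ge0.
Qed.

End Anisotropy.

(** * Plane vectors *)

Lemma dotvE {R : realType} (u v : 'cV[R]_2) :
  dotv u v = u 0 0 * v 0 0 + u 1 0 * v 1 0.
Proof.
rewrite /dotv mxE big_ord_recl big_ord1 !mxE.
by have -> : lift ord0 ord0 = 1 :> 'I_2 by apply/val_inj.
Qed.

Lemma enorm_ge0 {R : realType} (v : 'cV[R]_2) : 0 <= enorm v.
Proof. exact: sqrtr_ge0. Qed.

Lemma enorm_gt0 {R : realType} (v : 'cV[R]_2) : v != 0 -> 0 < enorm v.
Proof.
move=> v0; rewrite sqrtr_gt0 dotvE -!expr2 lt0r addr_ge0 ?sqr_ge0// andbT.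
apply: contra_neq v0 => /eqP; rewrite paddr_eq0 ?sqr_ge0// !sqrf_eq0.
move=> /andP[/eqP v0 /eqP v1]; apply/matrixP => i j; rewrite !mxE (ord1 j).
case: i => [[|[|//]]] i.
  by rewrite -[RHS]v0; congr (v _ _); apply/val_inj.
by rewrite -[RHS]v1; congr (v _ _); apply/val_inj.
Qed.

Lemma enormZ {R : realType} (c : R) (v : 'cV[R]_2) :
  0 <= c -> enorm (c *: v) = c * enorm v.
Proof.
move=> c0; rewrite /enorm !dotvE !mxE.
have -> : c * v 0 0 * (c * v 0 0) + c * v 1 0 * (c * v 1 0) =
  c ^+ 2 * (v 0 0 * v 0 0 + v 1 0 * v 1 0) by ring.
by rewrite sqrtrM ?sqr_ge0// sqrtr_sqr ger0_norm.
Qed.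

(** * Mass lumping on the elements *)

Section Elements.
Context {R : realType} (N : nat).
Context (N_gt0 : (0 < N)%N).
Implicit Types (f g u : R -> R) (X Y : R -> 'cV[R]_2).

Let NR_gt0 : 0 < N%:R :> R. Proof. by rewrite ltr0n. Qed.

Local Notation node := (node (R:=R) N).

Lemma node0 : node 0%N = 0. Proof. by rewrite /Defs.node mul0r. Qed.
Lemma nodeN : node N = 1. Proof. by rewrite /Defs.node divff// gt_eqF. Qed.

Lemma node_ltS j : node j < node j.+1.
Proof. by rewrite /Defs.node ltr_pM2r ?invr_gt0// ltr_nat. Qed.

Lemma nodeSB j : node j.+1 - node j = N%:R^-1.
Proof. by rewrite /Defs.node -mulrBl -addn1 natrD addrAC subrr add0r mul1r. Qed.

Lemma truncn_element j r : node j < r < node j.+1 -> Num.truncn (r * N%:R) = j.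
Proof.
rewrite /Defs.node ltr_pdivrMr// ltr_pdivlMr// => /andP[h1 h2].
by apply/truncn_def; rewrite (ltW h1).
Qed.

Lemma near_node_right j :
  \forall r \near (node j)^'+, node j < r < node j.+1.
Proof.
near=> r; apply/andP; split; near: r; first exact: nbhs_right_gt.
by apply: nbhs_right_lt; exact: node_ltS.
Unshelve. all: by end_near. Qed.

Lemma near_node_left j :
  \forall r \near (node j.+1)^'-, node j < r < node j.+1.
Proof.
near=> r; apply/andP; split; near: r; last exact: nbhs_left_lt.
by apply: nbhs_left_gt; exact: node_ltS.
Unshelve. all: by end_near. Qed.

Lemma Kh_affine u j r s : Kh N u -> (j < N)%N ->
  node j <= r <= node j.+1 -> node j <= s <= node j.+1 ->
  u r - u s = (r - s) * (N%:R * (u (node j.+1) - u (node j))).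
Proof.
move=> [_ uaff] jN rI sI; have [a [b uE]] := uaff _ jN.
have jI : node j <= node j <= node j.+1 by rewrite lexx ltW ?node_ltS.
have jSI : node j <= node j.+1 <= node j.+1 by rewrite lexx ltW ?node_ltS.
rewrite (uE r)// (uE s)// (uE (node j))// (uE (node j.+1))//.
have -> : a * node j.+1 + b - (a * node j + b) = a * (node j.+1 - node j) by ring.
by rewrite nodeSB; field; rewrite gt_eqF.
Qed.

(** The one-sided limits at both ends of each element: all that the lumped inner
    product sees of a function. *)
Definition elementwise_cvg f (l r : nat -> R) := forall j, (j < N)%N ->
  (f x @[x --> (node j)^'+] --> l j) * (f x @[x --> (node j.+1)^'-] --> r j).

Lemma elementwise_cvgD f g lf rf lg rg :
  elementwise_cvg f lf rf -> elementwise_cvg g lg rg ->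
  elementwise_cvg (fun x => f x + g x) (fun j => lf j + lg j)
    (fun j => rf j + rg j).
Proof.
move=> hf hg j jN; have [f1 f2] := hf j jN; have [g1 g2] := hg j jN.
by split; [exact: cvgD f1 g1|exact: cvgD f2 g2].
Qed.

Lemma elementwise_cvgM f g lf rf lg rg :
  elementwise_cvg f lf rf -> elementwise_cvg g lg rg ->
  elementwise_cvg (fun x => f x * g x) (fun j => lf j * lg j)
    (fun j => rf j * rg j).
Proof.
move=> hf hg j jN; have [f1 f2] := hf j jN; have [g1 g2] := hg j jN.
by split; [exact: cvgM f1 g1|exact: cvgM f2 g2].
Qed.

Lemma elementwise_cvg_const f (c : nat -> R) :
  (forall j r, (j < N)%N -> node j < r < node j.+1 -> f r = c j) ->
  elementwise_cvg f c c.
Proof.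
move=> fc j jN; split; apply: cvg_near_cst.
- by apply: filterS (near_node_right j) => r rj; exact: fc.
- by apply: filterS (near_node_left j) => r rj; exact: fc.
Qed.

Lemma elementwise_cvg_Kh u : Kh N u ->
  elementwise_cvg u (fun j => u (node j)) (fun j => u (node j.+1)).
Proof.
move=> uK j jN; set c := N%:R * (u (node j.+1) - u (node j)).
have jI : node j <= node j <= node j.+1 by rewrite lexx ltW ?node_ltS.
have jSI : node j <= node j.+1 <= node j.+1 by rewrite lexx ltW ?node_ltS.
have cont y : (u y + (x - y) * c) @[x --> y] --> u y.
  rewrite -[X in _ --> X]addr0 -[X in _ + X](mul0r c) -[X in X * _](subrr y).
  apply: cvgD; first exact: cvg_cst.
  apply: cvgM; last exact: cvg_cst.
  by apply: cvgB; [exact: cvg_id|exact: cvg_cst].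
split.
- apply: cvg_trans (cvg_at_right_filter (cont (node j))).
  apply: near_eq_cvg; apply: filterS (near_node_right j) => r /andP[r1 r2].
  by rewrite -(Kh_affine uK jN _ jI) ?ltW ?r1//; ring.
- apply: cvg_trans (cvg_at_left_filter (cont (node j.+1))).
  apply: near_eq_cvg; apply: filterS (near_node_left j) => r /andP[r1 r2].
  by rewrite -(Kh_affine uK jN _ jSI) ?ltW ?r1//; ring.
Qed.

Lemma elementwise_cvg_Xhp X i : Xhp N X ->
  elementwise_cvg (fun r => X r i 0) (fun j => X (node j) i 0)
    (fun j => X (node j.+1) i 0).
Proof. by move=> /(_ i)[XK _]; exact: elementwise_cvg_Kh. Qed.

Lemma lumpedE X f (l r : nat -> R) : elementwise_cvg f l r ->
  lumped N X f = 2^-1 * \sum_(j < N) enorm (edge N X j) * (l j + r j).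
Proof.
move=> h; congr (_ * _); apply: eq_bigr => j _.
have [h1 h2] := h _ (ltn_ord j).
by rewrite (cvg_lim _ h1)// (cvg_lim _ h2).
Qed.

(** On the interior of an element the difference quotient is eventually
    constant. *)
Lemma derive1_Xhp X j r : Xhp N X -> (j < N)%N -> node j < r < node j.+1 ->
  derive1 X r = N%:R *: edge N X j.
Proof.
move=> XX jN /andP[r1 r2]; rewrite /derive1.
apply: cvg_lim => //; apply: cvg_near_cst.
rewrite near_withinE.
have h0 : \forall h \near (0 : R), node j < h + r < node j.+1.
  have c : (h + r) @[h --> (0 : R)] --> r.
    by rewrite -[X in _ --> X]add0r; apply: cvgD; [exact: cvg_id|exact: cvg_cst].
  near=> h; apply/andP; split; near: h.
    exact: (cvgr_gt _ c).
  exact: (cvgr_lt _ c).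
near=> h => h_neq0.
have /andP[h1 h2] : node j < h + r < node j.+1 by near: h.
apply/matrixP => i k; rewrite (ord1 k) !mxE.
have [XK _] := XX i.
rewrite (Kh_affine XK jN) ?ltW ?h1 ?r1//.
by field.
Unshelve. all: by end_near. Qed.

(** The constant value of the half-step normal on an element; the mesh size
    cancels between the two parametric derivatives. *)
Definition element_normal X Y j : 'cV[R]_2 :=
  - (2^-1 / enorm (edge N X j)) *: perp (edge N X j + edge N Y j).

Lemma half_normal_element X Y j r : Xhp N X -> Xhp N Y -> (j < N)%N ->
  node j < r < node j.+1 ->
  half_normal X Y r = element_normal X Y j.
Proof.
move=> XX YY jN rj; rewrite /half_normal /element_normal.
rewrite !(derive1_Xhp _ jN rj)// enormZ ?ltW//.
apply/matrixP => i k; rewrite !mxE invfM.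
have N0 : N%:R != 0 :> R by rewrite gt_eqF.
set c := (enorm _)^-1.
by case: ifP => _; field.
Qed.

Lemma elementwise_cvg_half_normal X Y i : Xhp N X -> Xhp N Y ->
  elementwise_cvg (fun r => half_normal X Y r i 0)
    (fun j => element_normal X Y j i 0) (fun j => element_normal X Y j i 0).
Proof.
move=> XX YY; apply: elementwise_cvg_const => j r jN rj.
by rewrite (half_normal_element XX YY jN rj).
Qed.

Lemma ds_element X (V : lmodType R) (f : R -> V) j r : node j < r < node j.+1 ->
  ds N X f r = (enorm (edge N X j))^-1 *: (f (node j.+1) - f (node j)).
Proof. by move=> rj; rewrite /ds /piecewise_const (truncn_element rj). Qed.

Lemma Xhp_sub X Y : Xhp N X -> Xhp N Y -> Xhp N (fun r => Y r - X r).
Proof.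
move=> XX YY i; have [[Xc Xa] Xp] := XX i; have [[Yc Ya] Yp] := YY i.
have -> : (fun r => (Y r - X r) i 0) = (fun r => Y r i 0 - X r i 0).
  by apply/funext => r; rewrite !mxE.
split; last by rewrite Xp Yp.
split; first by move=> x; apply: cvgB; [exact: Yc|exact: Xc].
move=> j jN; have [a [b aE]] := Xa j jN; have [c [d cE]] := Ya j jN.
exists (c - a), (d - b) => r rj; rewrite aE// cE//; ring.
Qed.

Lemma Khp_cst (c : R) : Khp N (fun=> c).
Proof.
split => //; split; first exact: cst_continuous.
by move=> j jN; exists 0, c => r _; rewrite mul0r add0r.
Qed.

(** Covers the first terms of both equations of the scheme: c is the inverse time
    step in the first and 1 in the second. *)
Lemma elementwise_cvg_normal_velocity X Y u (c : R) :
  Xhp N X -> Xhp N Y -> Kh N u ->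
  let q j s := c * (u s * dotv (element_normal X Y j) (Y s - X s)) in
  elementwise_cvg (fun r => c * (u r * dotv (half_normal X Y r) (Y r - X r)))
    (fun j => q j (node j)) (fun j => q j (node j.+1)).
Proof.
move=> XX YY uK q; have DD := Xhp_sub XX YY.
have nE i := elementwise_cvg_half_normal i XX YY.
have DE i := elementwise_cvg_Xhp i DD.
have cE := @elementwise_cvg_const (fun=> c) (fun=> c) (fun _ _ _ _ => erefl).
have H := elementwise_cvgM cE (elementwise_cvgM (elementwise_cvg_Kh uK)
  (elementwise_cvgD (elementwise_cvgM (nE 0) (DE 0))
    (elementwise_cvgM (nE 1) (DE 1)))).
move=> j jN; rewrite /q !dotvE.
have -> : (fun r => c * (u r * dotv (half_normal X Y r) (Y r - X r))) =
  (fun r => c * (u r * (half_normal X Y r 0 0 * (Y r - X r) 0 0 +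
    half_normal X Y r 1 0 * (Y r - X r) 1 0))).
  by apply/funext => r; rewrite dotvE.
exact: H.
Qed.

Lemma mass_balance X theta Y mu (gamma k : R -> R) (tau : R) phi :
  Xhp N X -> (forall j, (j < N)%N -> edge N X j != 0) ->
  spfem_step N gamma k tau X theta Y mu -> Khp N phi ->
  2^-1 * \sum_(j < N) enorm (edge N X j) *
    (tau^-1 * (phi (node j)
       * dotv (element_normal X Y j) (Y (node j) - X (node j)))
   + tau^-1 * (phi (node j.+1)
       * dotv (element_normal X Y j) (Y (node j.+1) - X (node j.+1))))
  + \sum_(j < N) (enorm (edge N X j))^-1 *
      ((mu (node j.+1) - mu (node j)) * (phi (node j.+1) - phi (node j))) = 0.
Proof.
move=> XX eX [YY muK mass _] phiK; have := mass _ phiK.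
set fm := (fun r => _ * phi r); set fd := (fun r => ds N X (mu : R -> R^o) r * _).
have fmE : fm = (fun r => tau^-1 * (phi r * dotv (half_normal X Y r) (Y r - X r))).
  by apply/funext => r; rewrite /fm !dotvE !mxE; ring.
rewrite fmE (lumpedE X (elementwise_cvg_normal_velocity tau^-1 XX YY phiK.1)).
pose c j := (enorm (edge N X j))^-1 * (mu (node j.+1) - mu (node j)) *
  ((enorm (edge N X j))^-1 * (phi (node j.+1) - phi (node j))).
have fdE : elementwise_cvg fd c c.
  by apply: elementwise_cvg_const => j r jN rj; rewrite /fd !(ds_element _ _ rj).
rewrite (lumpedE X fdE) => E; rewrite -[RHS]E; congr (_ + _).
rewrite mulr_sumr; apply: eq_bigr => j _; rewrite /c.
have e0 : enorm (edge N X j) != 0 by rewrite gt_eqF// enorm_gt0// eX.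
by field.
Qed.

Lemma force_balance X theta Y mu (gamma k : R -> R) (tau : R) :
  Xhp N X -> (forall j, (j < N)%N -> edge N X j != 0) ->
  spfem_step N gamma k tau X theta Y mu ->
  2^-1 * \sum_(j < N) enorm (edge N X j) *
    (mu (node j) * dotv (element_normal X Y j) (Y (node j) - X (node j))
   + mu (node j.+1)
       * dotv (element_normal X Y j) (Y (node j.+1) - X (node j.+1)))
  = \sum_(j < N) (enorm (edge N X j))^-1 *
      dotv (energy_mx gamma k (theta j) *m edge N Y j) (edge N Y j - edge N X j).
Proof.
move=> XX eX [YY muK _ force]; have DD := Xhp_sub XX YY.
have := force _ DD.
set fm := (fun r => dotv (mu r *: _) _); set fd := (fun r => dotv (_ *m _) _).
have fmE : fm = (fun r => 1 * (mu r * dotv (half_normal X Y r) (Y r - X r))).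
  by apply/funext => r; rewrite /fm !dotvE !mxE; ring.
rewrite fmE (lumpedE X (elementwise_cvg_normal_velocity 1 XX YY muK.1)).
pose c j := (enorm (edge N X j))^-1 ^+ 2 *
  dotv (energy_mx gamma k (theta j) *m edge N Y j) (edge N Y j - edge N X j).
have fdE : elementwise_cvg fd c c.
  apply: elementwise_cvg_const => j r jN rj; rewrite /fd !(ds_element _ _ rj).
  rewrite /piecewise_const (truncn_element rj) /c.
  have -> : Y (node j.+1) - X (node j.+1) - (Y (node j) - X (node j)) =
      edge N Y j - edge N X j.
    by apply/matrixP => i l; rewrite !mxE; ring.
  rewrite -/(edge N Y j) -scalemxAr.
  set v := _ *m _; set w := _ - _; rewrite !dotvE.
  rewrite [(_ *: v) 0 0]mxE [(_ *: v) 1 0]mxE [(_ *: w) 0 0]mxE [(_ *: w) 1 0]mxE.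
  by ring.
rewrite (lumpedE X fdE) => /subr0_eq.
under eq_bigr do rewrite !mul1r.
move=> ->.
rewrite mulr_sumr; apply: eq_bigr => j _; rewrite /c.
have e0 : enorm (edge N X j) != 0 by rewrite gt_eqF// enorm_gt0// eX.
by field.
Qed.

End Elements.

(** * Local energy estimate *)

(** The stabilizing term projects onto the normal of the old edge, so it only sees
    the new edge, through the sine of the turning angle. *)
Lemma energy_mx_dotv {R : realType} (gamma k : R -> R) (a b t s : R) :
  dotv (energy_mx gamma k t *m (b *: vec2 (cos s) (sin s)))
    (b *: vec2 (cos s) (sin s) - a *: vec2 (cos t) (sin t)) =
    b ^+ 2 * (gamma t + k t * sin (s - t) ^+ 2)
    - a * b * (gamma t * cos (s - t) - derive1 gamma t * sin (s - t)).
Proof.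
have mul2 (A : 'M[R]_2) (v : 'cV[R]_2) i :
    (A *m v) i 0 = A i 0 * v 0 0 + A i 1 * v 1 0.
  rewrite mxE big_ord_recl big_ord1.
  by have -> : lift ord0 ord0 = 1 :> 'I_2 by apply/val_inj.
rewrite dotvE !mul2 !mxE /= sinB cosB.
rewrite -[X in b ^+ 2 * (X + _)]mulr1 -[X in gamma t * X + _](cos2Dsin2 s).
by ring.
Qed.

(** After division by the old length this is the stabilizing inequality with
    length ratio enorm v / enorm u and turning angle s - t. *)
Lemma edge_energy_le {R : realType} (gamma k : R -> R) (t s : R)
    (u v : 'cV[R]_2) :
  stabilizing gamma t (k t) -> u != 0 ->
  u = enorm u *: vec2 (cos t) (sin t) -> v = enorm v *: vec2 (cos s) (sin s) ->
  enorm v * gamma s - enorm u * gamma t <=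
    (enorm u)^-1 * dotv (energy_mx gamma k t *m v) (v - u).
Proof.
move=> [_ stab] /enorm_gt0 a0 uE vE; rewrite {3}uE {2 3}vE energy_mx_dotv.
have b0 := enorm_ge0 v; move: a0 b0 {uE vE}.
set a := enorm u; set b := enorm v => a0 b0.
have := stab (s - t) (b / a) (divr_ge0 b0 (ltW a0)).
rewrite /anisotropy [t + _]addrC subrK -(ler_pM2l a0) -subr_ge0 => H.
rewrite -subr_ge0 (le_trans H)// le_eqVlt; apply/orP; left; apply/eqP.
by field; rewrite gt_eqF.
Qed.

(** * One time step *)

Section Step.
Context {R : realType} (N : nat) (gamma k : R -> R) (tau : R).
Context (X Y : R -> 'cV[R]_2) (theta : nat -> R) (mu : R -> R).
Context (N_gt0 : (0 < N)%N) (tau_gt0 : 0 < tau).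
Context (XX : Xhp N X) (edgeX : forall j, (j < N)%N -> edge N X j != 0).
Context (stepXY : spfem_step N gamma k tau X theta Y mu).

Let tau_neq0 : tau != 0. Proof. by rewrite gt_eqF. Qed.
Let XY : Xhp N Y. Proof. by case: stepXY. Qed.

(** With D = Y - X and M = X + Y, the area is a quadratic form, whose increment is
    its polarization at D and M; symmetrizing the polarization costs a discrete
    integration by parts, of which T is the boundary term. *)
Lemma normal_velocity_area_term j : (j < N)%N ->
  let T i := 2^-1 * ((Y (node N i) 0 0 - X (node N i) 0 0) *
                    (Y (node N i) 1 0 + X (node N i) 1 0)) in
  enorm (edge N X j) *
    (dotv (element_normal N X Y j) (Y (node N j) - X (node N j))
   + dotv (element_normal N X Y j) (Y (node N j.+1) - X (node N j.+1)))
  = (Y (node N j.+1) 0 0 - Y (node N j) 0 0)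
      * (Y (node N j.+1) 1 0 + Y (node N j) 1 0)
  - (X (node N j.+1) 0 0 - X (node N j) 0 0)
      * (X (node N j.+1) 1 0 + X (node N j) 1 0)
  - 2 * (T j.+1 - T j).
Proof.
move=> jN T; have e0 : enorm (edge N X j) != 0 by rewrite gt_eqF// enorm_gt0// edgeX.
move: e0; rewrite /element_normal; set e := enorm _ => e0.
rewrite !dotvE !mxE /= /T; by field.
Qed.

Lemma area_step : area N Y = area N X.
Proof.
have := mass_balance N_gt0 XX edgeX stepXY (Khp_cst N 1).
rewrite [X in _ + X = _]big1 ?addr0; last by move=> j _; rewrite subrr !mulr0.
move=> mass0.
pose T i := 2^-1 * ((Y (node N i) 0 0 - X (node N i) 0 0) *
                    (Y (node N i) 1 0 + X (node N i) 1 0)).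
have Tper : \sum_(j < N) (T j.+1 - T j) = 0.
  rewrite -(big_mkord xpredT (fun j => T j.+1 - T j)) telescope_sumr//.
  rewrite /T node0 (nodeN N_gt0).
  have per Z i : Xhp N Z -> Z 1 i 0 = Z 0 i 0 :> R by move=> /(_ i)[_ /esym].
  by rewrite !(per X) ?(per Y)// subrr.
apply/eqP; rewrite -subr_eq0; apply/eqP.
rewrite -[RHS](mulr0 tau) -mass0 /area -mulrBr [RHS]mulrCA; congr (_ * _).
transitivity (\sum_(j < N) ((Y (node N j.+1) 0 0 - Y (node N j) 0 0)
      * (Y (node N j.+1) 1 0 + Y (node N j) 1 0)
    - (X (node N j.+1) 0 0 - X (node N j) 0 0)
      * (X (node N j.+1) 1 0 + X (node N j) 1 0) - 2 * (T j.+1 - T j))).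
  by rewrite [RHS]sumrB -mulr_sumr Tper mulr0 subr0 sumrB.
rewrite mulr_sumr.
apply: eq_bigr => j _; rewrite -normal_velocity_area_term//.
by field.
Qed.

Lemma energy_step (theta1 : nat -> R) :
  is_angle N X theta -> is_angle N Y theta1 ->
  (forall j, (j < N)%N -> stabilizing gamma (theta j) (k (theta j))) ->
  energy N gamma Y theta1 <= energy N gamma X theta.
Proof.
move=> aX aY stab; have muK : Khp N mu by case: stepXY.
have mass := mass_balance N_gt0 XX edgeX stepXY muK.
have force := force_balance N_gt0 XX edgeX stepXY.
rewrite -subr_le0 /energy -sumrB.
apply: (@le_trans _ _ (\sum_(j < N) (enorm (edge N X j))^-1 *
  dotv (energy_mx gamma k (theta j) *m edge N Y j) (edge N Y j - edge N X j))).
  apply: ler_sum => j _; apply: edge_energy_le.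
  - exact: stab.
  - exact: edgeX.
  - exact: aX.
  - exact: aY.
rewrite -force.
have E : 2^-1 * \sum_(j < N) enorm (edge N X j) *
    (tau^-1 * (mu (node N j)
       * dotv (element_normal N X Y j) (Y (node N j) - X (node N j)))
   + tau^-1 * (mu (node N j.+1)
       * dotv (element_normal N X Y j) (Y (node N j.+1) - X (node N j.+1)))) =
  tau^-1 * (2^-1 * \sum_(j < N) enorm (edge N X j) *
    (mu (node N j)
       * dotv (element_normal N X Y j) (Y (node N j) - X (node N j))
   + mu (node N j.+1)
       * dotv (element_normal N X Y j) (Y (node N j.+1) - X (node N j.+1)))).
  by rewrite mulrCA; congr (_ * _); rewrite mulr_sumr; apply: eq_bigr => j _; ring.
move: mass; rewrite E => /eqP; rewrite addr_eq0 => /eqP mass.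
rewrite -(pmulr_rle0 _ (_ : 0 < tau^-1)) ?invr_gt0// mass oppr_le0.
apply: sumr_ge0 => j _; apply: mulr_ge0; first by rewrite invr_ge0 enorm_ge0.
by rewrite -expr2 sqr_ge0.
Qed.

End Step.

(** * Area conservation and energy dissipation *)

Theorem theorem3p1 (R : realType) (gamma : R -> R)
  (gamma_per : periodic gamma (2 * pi))
  (gamma_gt0 : forall t, 0 < gamma t)
  (gamma_C1 : C1 gamma)
  (gamma_pC2 : piecewise_C2 gamma)
  (gamma_a : forall t, gamma (t - pi) <= 3 * gamma t)
  (gamma_b : forall t, 3 * gamma t = gamma (t - pi) -> derive1 gamma t = 0) :
  exists kstar : R -> R,
    [/\ periodic kstar (2 * pi),
        forall t, 0 <= kstar t
      & forall k : R -> R,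
          periodic k (2 * pi) ->
          (forall t, 0 <= k t) ->
          (forall t, kstar t <= k t) ->
        forall (N : nat) (tau : R), (2 < N)%N -> 0 < tau ->
        forall Xinit : R -> 'cV[R]_2,
          {within `[0, 1], continuous Xinit} -> Xinit 0 = Xinit 1 ->
        forall (X : nat -> R -> 'cV[R]_2) (theta : nat -> nat -> R)
               (mu : nat -> R -> R),
          spfem_solution N gamma k tau Xinit X theta mu ->
        forall m : nat,
          (area N (X m.+1) = area N (X m) /\ area N (X m) = area N (X 0%N)) /\
          energy N gamma (X m.+1) (theta m.+1)
            <= energy N gamma (X m) (theta m)
            <= energy N gamma (X 0%N) (theta 0%N)].
Proof.
have stab t : stabilizing gamma t (xget 0 (stabilizing gamma t)).
  apply: xgetPex.
  exact: (stabilizing_exists gamma_per gamma_gt0 gamma_C1 gamma_pC2 gamma_a gamma_b t).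
exists (fun t => xget 0 (stabilizing gamma t)); split.
- move=> t; congr (xget _ _).
  exact: stabilizing_per.
- by move=> t; case: (stab t).
move=> k _ _ kstar_le N tau N2 tau0 Xinit _ _ X theta mu [X0 _ edgeX angleX stepX].
have N0 : (0 < N)%N by apply: leq_ltn_trans N2.
have XX m : Xhp N (X m) by case: m => [//|m]; case: (stepX m).
have stabk t : stabilizing gamma t (k t) by exact: stabilizing_le (stab t).
have areaS m : area N (X m.+1) = area N (X m).
  exact: (area_step N0 tau0 (XX m) (edgeX m) (stepX m)).
have energyS m : energy N gamma (X m.+1) (theta m.+1) <= energy N gamma (X m) (theta m).
  by apply: (energy_step N0 tau0 (XX m) (edgeX m) (stepX m)).
move=> m; split; first by split => //; elim: m => // m IH; rewrite areaS.
by rewrite energyS/=; elim: m => // m; apply: le_trans.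
Qed.
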